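(* Let $\{\mathbb{X}_n\}_{n\in\mathbb{N}}$ be a sequence of non-trivial normed linear spaces over $\mathbb{K}$ and let $p\in(1,\infty)$. Then $$\mathcal{D}\left(\bigoplus_p\mathbb{X}_n\right)=\sup_{n\in\mathbb{N}}\mathcal{D}(\mathbb{X}_n).$$
   Context: $\mathbb{K}=\mathbb{R}$ or $\mathbb{C}$; non-trivial means of dimension more than $0$. For $1\le p<\infty$, $\bigoplus_p\mathbb{X}_n$ is the space of sequences $\{x_n\}$ with $x_n\in\mathbb{X}_n$ and $\sum_n\|x_n\|^p<\infty$, with norm $\|\{x_n\}\|_p=(\sum_n\|x_n\|^p)^{1/p}$. For a non-zero $x$ in a normed space $\mathbb{X}$, $J(x)=\{f\in\mathbb{X}^*:\|f\|=1,\ f(x)=\|x\|\}$, $D(x)=\operatorname{diam}(J(x))$ (diameter in the norm of $\mathbb{X}^*$), and $\mathcal{D}(\mathbb{X})=\sup\{D(x):x\in\mathbb{X}\setminus\{0\}\}$. *)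

(* Defs.v *)
From HB Require Import structures.
From mathcomp Require Import all_boot all_order all_algebra.
From mathcomp Require Import complex.
From mathcomp Require Import all_classical all_reals all_analysis.

Set Implicit Arguments.
Unset Strict Implicit.
Unset Printing Implicit Defensive.
Import Order.TTheory GRing.Theory Num.Theory.
Import numFieldNormedType.Exports.

Local Open Scope classical_set_scope.
Local Open Scope ring_scope.

Variant scalar_kind := RealScalars | ComplexScalars.

Definition scalars (R : realType) (k : scalar_kind) : numFieldType :=
  match k with RealScalars => R | ComplexScalars => complex R end.

Definition of_real (R : realType) (k : scalar_kind) : R -> scalars R k :=
  match k with
  | RealScalars => fun r => r
  | ComplexScalars => fun r => Complex r 0
  end.
Arguments of_real {R k} _.

Definition real_part (R : realType) (k : scalar_kind) : scalars R k -> R :=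
  match k with
  | RealScalars => fun r => r
  | ComplexScalars => fun z => complex.Re z
  end.
Arguments real_part {R k} _.

(* The norm of a normed module over K takes its values in K itself;
   [rnorm x] is the same number in R, see [of_real_rnorm]. *)
Definition rnorm (R : realType) (k : scalar_kind)
    (X : normedModType (scalars R k)) (x : X) : R :=
  real_part `|x|.

Section scalars_theory.
Variables (R : realType) (k : scalar_kind).
Local Notation K := (scalars R k).
Implicit Types r s : R.

Lemma real_partK r : real_part (of_real r : K) = r.
Proof. by case: k. Qed.

Lemma of_real0 : of_real 0 = 0 :> K.
Proof. by case: k. Qed.

Lemma of_realD r s : of_real (r + s) = of_real r + of_real s :> K.
Proof. by case: k => //=; apply/eqP; rewrite eq_complex /= addr0 !eqxx. Qed.

Lemma of_realM r s : of_real (r * s) = of_real r * of_real s :> K.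
Proof.
by case: k => //=; apply/eqP; rewrite eq_complex /= !(mulr0, mul0r, addr0, subr0) !eqxx.
Qed.

Lemma ler_of_real r s : (of_real r <= of_real s :> K) = (r <= s).
Proof. by case: k => //=; rewrite lecE /= eqxx. Qed.

Lemma of_real_norm (z : K) : 0 <= z -> of_real (real_part z) = z.
Proof.
case: k z => //= -[a b]; rewrite lecE /= => /andP[/eqP -> _].
by [].
Qed.

Variable X : normedModType K.
Implicit Types x y : X.

Lemma of_real_rnorm x : of_real (rnorm x) = `|x|.
Proof. by rewrite of_real_norm. Qed.

Lemma rnorm_ge0 x : 0 <= rnorm x.
Proof. by rewrite -(ler_of_real) of_real_rnorm of_real0. Qed.

Lemma rnormD x y : rnorm (x + y) <= rnorm x + rnorm y.
Proof. by rewrite -ler_of_real of_realD !of_real_rnorm ler_normD. Qed.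

Lemma rnormZ (a : K) x : rnorm (a *: x) = real_part `|a| * rnorm x.
Proof.
apply: (can_inj real_partK).
by rewrite of_realM !of_real_rnorm of_real_norm// normrZ.
Qed.

Lemma rnorm0 : rnorm (0 : X) = 0.
Proof.
by apply: (can_inj real_partK); rewrite of_real_rnorm normr0 of_real0.
Qed.

Lemma rnorm0_eq0 x : rnorm x = 0 -> x = 0.
Proof. by move=> x0; apply/normr0_eq0; rewrite -of_real_rnorm x0 of_real0. Qed.

Lemma rnormN x : rnorm (- x) = rnorm x.
Proof. by rewrite /rnorm normrN. Qed.

End scalars_theory.

Definition psum (R : realType) (p : R) (u : nat -> R) : \bar R :=
  (\sum_(0 <= n <oo) (u n `^ p)%:E)%E.

Section psum_theory.
Variables (R : realType) (p : R).
Hypothesis p1 : 1 <= p.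
Implicit Types u v w : nat -> R.
Local Notation S := (psum p).

Let p0 : 0 < p. Proof. exact: lt_le_trans p1. Qed.

Lemma psum_ge0 u : (0 <= S u)%E.
Proof. by apply: nneseries_ge0 => n _ _; rewrite lee_fin powR_ge0. Qed.

Lemma psum_fin u : (S u < +oo)%E -> S u \is a fin_num.
Proof. by move=> Su; rewrite ge0_fin_numE// psum_ge0. Qed.

Lemma le_psum u v : (forall n, 0 <= u n <= v n) -> (S u <= S v)%E.
Proof.
move=> uv; apply: lee_nneseries => n _ //; first by rewrite lee_fin powR_ge0.
have /andP[u0 unvn] := uv n.
by rewrite lee_fin ge0_ler_powR ?nnegrE ?(ltW p0)// (le_trans u0).
Qed.

Lemma psum0 : S (fun=> 0) = 0%E.
Proof. by apply: eseries0 => n _ _; rewrite powR0// gt_eqF. Qed.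

Lemma psumZ c u : 0 <= c -> (forall n, 0 <= u n) ->
  S (fun n => c * u n) = ((c `^ p)%:E * S u)%E.
Proof.
move=> c0 u0; rewrite -nneseriesZl; last by move=> n _; rewrite lee_fin powR_ge0.
by apply: eq_eseriesr => n _; rewrite powRM// EFinM.
Qed.

Lemma psum_eq0 u : S u = 0%E -> forall n, u n = 0.
Proof.
move=> Su n; have : ((u n `^ p)%:E <= S u)%E.
  apply: (@le_trans _ _ (\sum_(0 <= i < n.+1) (u i `^ p)%:E)%E).
    rewrite big_nat_recr//= leeDr// sume_ge0// => i _.
    by rewrite lee_fin powR_ge0.
  by apply: nneseries_lim_ge => i _; rewrite lee_fin powR_ge0.
by rewrite Su lee_fin => up; apply: (@powR_eq0_eq0 _ _ p);
  apply/eqP; rewrite eq_le up powR_ge0.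
Qed.


Lemma Lnorm_psum u : (forall n, 0 <= u n) ->
  'N[counting]_p%:E[EFin \o u]%E = (S u `^ p^-1)%E.
Proof.
move=> u0; rewrite Lnorm_counting//; congr (_ `^ _)%E.
by apply: eq_eseriesr => n _ /=; rewrite ger0_norm.
Qed.

Lemma psum_minkowski u v w :
    (forall n, 0 <= u n) -> (forall n, 0 <= v n) ->
    (forall n, 0 <= w n <= u n + v n) -> (S u < +oo)%E -> (S v < +oo)%E ->
  (S w < +oo)%E /\
  fine (S w) `^ p^-1 <= fine (S u) `^ p^-1 + fine (S v) `^ p^-1.
Proof.
move=> u0 v0 wuv Su Sv.
have uv0 n : 0 <= (u \+ v) n by rewrite /= addr_ge0.
have pV0 : 0 < p^-1 by rewrite invr_gt0.
have Mink : (S (u \+ v)%R `^ p^-1 <= S u `^ p^-1 + S v `^ p^-1)%E.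
  by rewrite -!Lnorm_psum//; apply: minkowski_EFin.
have Suv : (S (u \+ v)%R < +oo)%E.
  apply: (@lty_poweRy _ _ p^-1); first by rewrite gt_eqF.
  by apply: le_lt_trans Mink _; rewrite lte_add_pinfty// poweR_lty.
have Sw : (S w <= S (u \+ v)%R)%E by exact: le_psum.
have Swoo := le_lt_trans Sw Suv.
split=> //; move: Mink.
rewrite -(fineK (psum_fin Suv)) -(fineK (psum_fin Su)) -(fineK (psum_fin Sv)).
rewrite !poweR_EFin -EFinD lee_fin; apply: le_trans.
apply: ge0_ler_powR; rewrite ?nnegrE ?fine_ge0 ?psum_ge0//; first exact: ltW.
by rewrite fine_le ?psum_fin.
Qed.

End psum_theory.

(* The sequences (x_n) with x_n in X_n and \sum_n ||x_n||^p finite.  The proof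
   of 1 <= p is part of the type because the norm depends on it. *)
Record lpsum (R : realType) (k : scalar_kind) (p : R) (p1 : 1 <= p)
    (X : nat -> normedModType (scalars R k)) := LpSum {
  lpval :> forall n, X n;
  lpvalP : (psum p (fun n => rnorm (lpval n)) < +oo)%E
}.

HB.instance Definition _ (R : realType) (k : scalar_kind) (p : R)
  (p1 : 1 <= p) (X : nat -> normedModType (scalars R k)) :=
  gen_eqMixin (lpsum p1 X).
HB.instance Definition _ (R : realType) (k : scalar_kind) (p : R)
  (p1 : 1 <= p) (X : nat -> normedModType (scalars R k)) :=
  gen_choiceMixin (lpsum p1 X).

Section lpsum_normedModule.
Variables (R : realType) (k : scalar_kind) (p : R) (p1 : 1 <= p).
Local Notation K := (scalars R k).
Variable X : nat -> normedModType K.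
Local Notation E := (lpsum p1 X).
Implicit Types x y z : E.

Let p0 : 0 < p. Proof. exact: lt_le_trans p1. Qed.

Lemma lpsumP x y : (forall n, x n = y n) -> x = y.
Proof.
case: x y => [x xP] [y yP] /= xy.
have {}xy : x = y by exact: functional_extensionality_dep.
by subst y; congr LpSum; exact: Prop_irrelevance.
Qed.

Let zeroP : (psum p (fun n => rnorm (0%R : X n)) < +oo)%E.
Proof.
rewrite (_ : (fun _ => _) = fun=> 0); last by apply/funext => n; exact: rnorm0.
by rewrite psum0// ltry.
Qed.

Let addP x y : (psum p (fun n => rnorm (x n + y n)%R) < +oo)%E.
Proof.
apply: (psum_minkowski p1 _ _ _ (lpvalP x) (lpvalP y)).1 => n /=;
  by rewrite rnorm_ge0// rnormD.
Qed.

Let oppP x : (psum p (fun n => rnorm (- x n)%R) < +oo)%E.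
Proof.
rewrite (_ : (fun _ => _) = fun n => rnorm (x n)); first exact: lpvalP.
by apply/funext => n; exact: rnormN.
Qed.

Let psum_scale (a : K) x : psum p (fun n => rnorm (a *: x n)) =
  ((real_part `|a| `^ p)%R%:E * psum p (fun n => rnorm (x n)))%E.
Proof.
rewrite (_ : (fun _ => _) = fun n => real_part `|a| * rnorm (x n)); last first.
  by apply/funext => n; exact: rnormZ.
by rewrite psumZ// => [|n]; [exact: (@rnorm_ge0 _ _ K^o) | exact: rnorm_ge0].
Qed.

Let scaleP (a : K) x : (psum p (fun n => rnorm (a *: x n)%R) < +oo)%E.
Proof. by rewrite psum_scale lte_mul_pinfty ?lee_fin ?powR_ge0 ?lpvalP. Qed.

Definition lpsum_zero : E := LpSum p1 zeroP.
Definition lpsum_add x y : E := LpSum p1 (addP x y).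
Definition lpsum_opp x : E := LpSum p1 (oppP x).
Definition lpsum_scale (a : K) x : E := LpSum p1 (scaleP a x).

Let addA : associative lpsum_add.
Proof. by move=> x y z; apply: lpsumP => n; exact: addrA. Qed.

Let addC : commutative lpsum_add.
Proof. by move=> x y; apply: lpsumP => n; exact: addrC. Qed.

Let add0 : left_id lpsum_zero lpsum_add.
Proof. by move=> x; apply: lpsumP => n; exact: add0r. Qed.

Let addN : left_inverse lpsum_zero lpsum_opp lpsum_add.
Proof. by move=> x; apply: lpsumP => n; exact: addNr. Qed.

HB.instance Definition _ := GRing.isZmodule.Build E addA addC add0 addN.

Let scaleA a b x : lpsum_scale a (lpsum_scale b x) = lpsum_scale (a * b) x.
Proof. by apply: lpsumP => n; exact: scalerA. Qed.

Let scale1 : left_id 1 lpsum_scale.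
Proof. by move=> x; apply: lpsumP => n; exact: scale1r. Qed.

Let scaleDr : right_distributive lpsum_scale +%R.
Proof. by move=> a x y; apply: lpsumP => n; exact: scalerDr. Qed.

Let scaleDl x : {morph lpsum_scale^~ x : a b / a + b}.
Proof. by move=> a b; apply: lpsumP => n; exact: scalerDl. Qed.

HB.instance Definition _ :=
  GRing.Zmodule_isLmodule.Build K E scaleA scale1 scaleDr scaleDl.

Definition lpnorm x : R := fine (psum p (fun n => rnorm (x n))) `^ p^-1.

Let normD x y :
  of_real (lpnorm (x + y)) <= of_real (lpnorm x) + of_real (lpnorm y) :> K.
Proof.
rewrite -of_realD ler_of_real.
apply: (psum_minkowski p1 _ _ _ (lpvalP x) (lpvalP y)).2 => n /=;
  by rewrite rnorm_ge0// rnormD.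
Qed.

Let normZ (a : K) x :
  of_real (lpnorm (a *: x)) = `|a| * of_real (lpnorm x) :> K.
Proof.
have a0 : 0 <= real_part `|a| by exact: (@rnorm_ge0 _ _ K^o).
rewrite /lpnorm /= psum_scale fineM ?psum_fin ?lpvalP//=.
rewrite powRM ?powR_ge0 ?fine_ge0 ?psum_ge0//.
by rewrite -powRrM mulfV ?gt_eqF// powRr1// of_realM of_real_norm.
Qed.

Let norm0_eq0 x : of_real (lpnorm x) = 0 :> K -> x = 0.
Proof.
move=> /(congr1 real_part); rewrite real_partK -(of_real0 R k) real_partK.
move=> /powR_eq0_eq0 Sx; apply: lpsumP => n /=; apply: rnorm0_eq0.
apply: (@psum_eq0 _ p (fun n => rnorm (x n))).
by rewrite -(fineK (psum_fin (lpvalP x))) Sx.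
Qed.

HB.instance Definition _ := Lmodule_isNormed.Build K E normD normZ norm0_eq0.

End lpsum_normedModule.

(* The norm of the sum is (\sum_n ||x_n||^p)^(1/p), as a real number. *)
Lemma rnorm_lpsum (R : realType) (k : scalar_kind) (p : R) (p1 : 1 <= p)
    (X : nat -> normedModType (scalars R k)) (x : lpsum p1 X) :
  rnorm x = fine (\sum_(0 <= n <oo) (rnorm (x n) `^ p)%:E)%E `^ p^-1.
Proof. exact: real_partK. Qed.

Section duality_map.
Variables (R : realType) (k : scalar_kind).
Local Notation K := (scalars R k).
Variable X : normedModType K.

(* The operator norm of f; it is +oo when f is unbounded. *)
Definition dual_norm (f : X -> K) : \bar R :=
  ereal_sup [set (rnorm (f x : K^o))%:E | x in [set x : X | rnorm x <= 1]].

(* J(x); it is only meaningful for x != 0. *)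
Definition support_functionals (x : X) : set {linear X -> K^o} :=
  [set f | [/\ continuous f, dual_norm f = 1%E & f x = `|x|]].

Definition dual_diam (A : set {linear X -> K^o}) : \bar R :=
  ereal_sup [set d | exists f g, [/\ A f, A g & d = dual_norm (f \- g)]].

(* D(x) = diam J(x) *)
Definition local_diam (x : X) : \bar R := dual_diam (support_functionals x).

(* The supremum of D(x) over the nonzero x, taken in \bar R. *)
Definition global_diam : \bar R :=
  ereal_sup [set local_diam x | x in [set x : X | x != 0]].

End duality_map.

(* Main.v *)
(** Let [x] have norm one in the sum and let [F] support it.  The inequality
    [p (Re F (x + z) - 1) <= ||x + z||^p - 1], applied to [z] in the n-th
    summand, bounds [Re F z] by a difference of p-th powers of norms in
    [X_n]; dividing by the size of [z] and letting it tend to [0] shows that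
    [F] restricted to [X_n] is [||x_n||^(p-1)] times a functional supporting
    [x_n] (and vanishes if [x_n = 0]).  So for two supporting functionals [F]
    and [G] of [x], Hoelder's inequality bounds [F - G] on finitely supported
    sequences, hence everywhere by density.  Conversely [f \o lpproj] supports
    [lpsingle x] when [f] supports [x].  The Hahn-Banach theorem is not needed:
    if [J(x)] is empty then its diameter, a supremum in [\bar R], is [-oo]. *)
Require Import Defs.
From HB Require Import structures.
From mathcomp Require Import all_boot all_order all_algebra.
From mathcomp Require Import complex.
From mathcomp Require Import all_classical all_reals all_analysis.
From mathcomp Require Import ring lra.

Set Implicit Arguments.
Unset Strict Implicit.
Unset Printing Implicit Defensive.
Import Order.TTheory GRing.Theory Num.Theory.
Import numFieldNormedType.Exports.

Local Open Scope classical_set_scope.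
Local Open Scope ring_scope.

(** * Convexity and one-sided continuity of real powers *)

Section powR_inequalities.
Variable R : realType.
Implicit Types a b c p r u w : R.

(** The convex function t^p lies above its tangent at [w]. This is Young's inequality for the
    product of [u] and w^(p-1), with conjugate exponents [p] and p/(p-1), after clearing
    denominators. *)
Lemma powR_tangent p u w : 1 < p -> 0 <= u -> 0 <= w ->
  w `^ p + p * w `^ (p - 1) * (u - w) <= u `^ p.
Proof.
move=> p1 u0 w0; have p0 : 0 < p by exact: lt_trans p1.
have r0 : 0 < p - 1 by rewrite subr_gt0.
have pq : p^-1 + (p / (p - 1))^-1 = 1.
  by field; rewrite !gt_eqF.
have q0 : 0 < p / (p - 1) by rewrite divr_gt0.
have := conjugate_powR u0 (powR_ge0 w (p - 1)) p0 q0 pq.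
have pr : (p - 1) * (p / (p - 1)) = p by rewrite mulrC divfK ?gt_eqF.
rewrite -powRrM pr -(ler_pM2l p0).
have -> : p * (u `^ p / p + w `^ p / (p / (p - 1))) = u `^ p + (p - 1) * w `^ p.
  by field; rewrite !gt_eqF.
have := mulr_powRB1 w0 p0.
set v := w `^ (p - 1); set wp := w `^ p; set up := u `^ p => <-.
nra.
Qed.

(** The tangent inequality at [u], evaluated at [w]: Young's inequality in a form free of the
    conjugate exponent. *)
Lemma mul_powR_young p u w : 1 < p -> 0 <= u -> 0 <= w ->
  p * (u `^ (p - 1) * w) <= w `^ p + (p - 1) * u `^ p.
Proof.
move=> p1 u0 w0; have := powR_tangent p1 w0 u0.
rewrite -(mulr_powRB1 u0 (lt_trans ltr01 p1)); set v := u `^ (p - 1).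
by move=> ?; lra.
Qed.

(** Right continuity of the power function with an explicit witness: the r-th root of the midpoint
    of a^r and [c]. *)
Lemma powR_gt_approx r a c : 0 < r -> 0 <= a -> a `^ r < c ->
  exists2 w, a < w & w `^ r < c.
Proof.
move=> r0 a0 ac; have ar0 := powR_ge0 a r.
have m0 : 0 <= (a `^ r + c) / 2 by lra.
have wr : ((a `^ r + c) / 2) `^ r^-1 `^ r = (a `^ r + c) / 2.
  by rewrite -powRrM mulVf ?gt_eqF// powRr1.
exists (((a `^ r + c) / 2) `^ r^-1); last by rewrite wr; lra.
rewrite ltNge; apply/negP => /(ge0_ler_powR (ltW r0)).
by rewrite !nnegrE powR_ge0 => /(_ isT a0); rewrite wr; lra.
Qed.

Lemma powR_lt_approx r a c : 0 < r -> 0 <= a -> 0 <= c -> c < a `^ r ->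
  exists2 w, 0 <= w < a & c < w `^ r.
Proof.
move=> r0 a0 c0 ca.
have m0 : 0 <= (a `^ r + c) / 2 by lra.
have wr : ((a `^ r + c) / 2) `^ r^-1 `^ r = (a `^ r + c) / 2.
  by rewrite -powRrM mulVf ?gt_eqF// powRr1.
exists (((a `^ r + c) / 2) `^ r^-1); last by rewrite wr; lra.
rewrite powR_ge0 ltNge; apply/negP => /(ge0_ler_powR (ltW r0)).
by rewrite !nnegrE powR_ge0 => /(_ a0 isT); rewrite wr; lra.
Qed.

(** The limit as [w] decreases to [a]: if the bound failed at [a], [powR_gt_approx] would make it
    fail at some larger [w] too. *)
Lemma le_mul_powR_gt r a b c : 0 < r -> 0 <= a -> 0 < b ->
  (forall w, a < w -> c <= b * w `^ r) -> c <= b * a `^ r.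
Proof.
move=> r0 a0 b0 cw; rewrite leNgt mulrC -ltr_pdivlMr//; apply/negP.
move=> /(powR_gt_approx r0 a0)[w /cw]; rewrite ltr_pdivlMr// mulrC.
by move=> /le_lt_trans /[apply]; rewrite ltxx.
Qed.

Lemma ge_mul_powR_lt r a b c : 0 < r -> 0 < a -> 0 < b ->
  (forall w, 0 <= w < a -> b * w `^ r <= c) -> b * a `^ r <= c.
Proof.
move=> r0 a0 b0 cw; have c0 : 0 <= c.
  by have := cw 0; rewrite lexx a0 powR0 ?gt_eqF// mulr0 => /(_ isT).
rewrite leNgt mulrC -ltr_pdivrMr//; apply/negP.
move=> /(powR_lt_approx r0 (ltW a0))[|w /cw]; first by rewrite divr_ge0// ltW.
by rewrite ltr_pdivrMr// mulrC => /le_lt_trans /[apply]; rewrite ltxx.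
Qed.

End powR_inequalities.

(** * Real and complex scalars treated uniformly *)

Section scalars.
Variables (R : realType) (k : scalar_kind).
Local Notation K := (scalars R k).
Implicit Types (z : K) (r : R).

Lemma real_partD z1 z2 : real_part (z1 + z2) = real_part z1 + real_part z2.
Proof. by case: k z1 z2 => //= -[a b] [c d]. Qed.

Lemma real_part_ofM r z : real_part (of_real r * z) = r * real_part z.
Proof. by case: k z => //= -[a b] /=; rewrite mul0r subr0. Qed.

Lemma real_part1 : real_part (1 : K) = 1.
Proof. by case: k. Qed.

Lemma of_real1 : of_real 1 = 1 :> K.
Proof. by case: k. Qed.

Lemma real_part_le z : real_part z <= rnorm (z : K^o).
Proof.
rewrite /rnorm; case: k z => [z|z] /=; first exact: ler_norm.
have := normc_ge_Re z; rewrite lecE /= => /andP[_].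
exact: le_trans (ler_norm _).
Qed.

(** For z = a + ib, the bounds a^2 + b^2 <= r^2 and 0 <= r <= a leave no room for b. *)
Lemma real_part_eq_of_real z r :
  rnorm (z : K^o) <= r -> r <= real_part z -> z = of_real r.
Proof.
rewrite /rnorm; case: k z => [z|[a b]] /= zr rz.
  by apply/eqP; rewrite eq_le rz (le_trans (ler_norm z)).
have r0 : 0 <= r by rewrite (le_trans _ zr)// sqrtr_ge0.
have : a ^+ 2 + b ^+ 2 <= r ^+ 2.
  rewrite -(@sqr_sqrtr _ (a ^+ 2 + b ^+ 2)) ?addr_ge0 ?sqr_ge0//.
  by rewrite ler_pXn2r ?nnegrE ?sqrtr_ge0.
have := sqr_ge0 b; rewrite !expr2 => b2 ab; have ar : a = r by nra.
have /eqP : b * b = 0 by apply/eqP; rewrite eq_le b2 andbT; nra.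
by rewrite mulf_eq0 orbb => /eqP ->; rewrite ar.
Qed.

Lemma rnorm_of_real r : 0 <= r -> rnorm (of_real r : K^o) = r.
Proof.
move=> r0; rewrite /rnorm ger0_norm ?real_partK//.
by rewrite -(of_real0 R k) ler_of_real.
Qed.

(** Turns a bound on real parts of a functional into a bound on its modulus. *)
Lemma scalar_rotation z :
  exists2 u : K, real_part `|u| = 1 & u * z = of_real (rnorm (z : K^o)).
Proof.
rewrite of_real_rnorm; have [->|z0] := eqVneq z 0.
  exists 1; last by rewrite normr0 mulr0.
  by rewrite normr1 real_part1.
exists (`|z| / z); last by rewrite divfK.
rewrite normrM normfV normr_id divff ?normr_eq0//.
exact: real_part1.
Qed.

End scalars.

(** * The dual norm and a pointwise criterion for support functionals *)

Section dual_norm.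
Variables (R : realType) (k : scalar_kind).
Local Notation K := (scalars R k).
Variable X : normedModType K.
Implicit Types (f g : {linear X -> K^o}) (x y : X) (M r : R).

Lemma rnormZ_of_real r x : 0 <= r -> rnorm (of_real r *: x) = r * rnorm x.
Proof. by move=> r0; rewrite rnormZ; congr (_ * _); exact: rnorm_of_real. Qed.

Lemma rnorm_gt0 x : (0 < rnorm x) = (x != 0).
Proof.
rewrite lt_neqAle rnorm_ge0 andbT eq_sym; congr (~~ _).
by apply/eqP/eqP => [/rnorm0_eq0|->]; rewrite ?rnorm0.
Qed.

Lemma dual_norm_ge0 f : (0 <= dual_norm f)%E.
Proof.
apply: ereal_sup_ubound; exists 0; first by rewrite /= rnorm0.
by rewrite linear0 rnorm0.
Qed.

Lemma dual_norm_leP f M : 0 <= M ->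
  (dual_norm f <= M%:E)%E <-> forall x, rnorm (f x : K^o) <= M * rnorm x.
Proof.
move=> M0; split=> [fM x|fM]; last first.
  apply: ge_ereal_sup => _ [x /= x1 <-]; rewrite lee_fin.
  by apply: le_trans (fM x) _; rewrite ler_piMr.
have [->|x0] := eqVneq x 0; first by rewrite linear0 !rnorm0 mulr0.
have nx : 0 < rnorm x by rewrite rnorm_gt0.
pose y : X := of_real (rnorm x)^-1 *: x.
have : ((rnorm (f y : K^o))%:E <= M%:E)%E.
  apply: le_trans fM; apply: ereal_sup_ubound; exists y => //=.
  by rewrite rnormZ_of_real ?mulVf ?gt_eqF// invr_ge0 ltW.
rewrite lee_fin /y linearZ.
rewrite [X in X <= _](_ : _ = (rnorm x)^-1 * rnorm (f x : K^o)).
  by rewrite ler_pdivrMl// mulrC.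
by rewrite rnormZ; congr (_ * _); apply: rnorm_of_real; rewrite invr_ge0 ltW.
Qed.

Lemma bounded_functional_continuous f M :
  (forall x, rnorm (f x : K^o) <= M * rnorm x) -> continuous f.
Proof.
move=> fM; apply: bounded_linear_continuous; apply/linear_boundedP.
near=> r => x; rewrite -(of_real_rnorm (f x : K^o)).
apply: (@le_trans _ _ (of_real M * `|x|)).
  by rewrite -of_real_rnorm -of_realM ler_of_real.
apply: ler_wpM2r => //; near: r; apply: nbhs_pinfty_ge.
by rewrite realE -(of_real0 R k) !ler_of_real le_total.
Unshelve. all: by end_near. Qed.

Lemma support_functionalP f x : x != 0 ->
  support_functionals x f <->
  f x = `|x| /\ forall y, rnorm (f y : K^o) <= rnorm y.
Proof.
move=> x0; split=> [[_ f1 fx]|[fx f1]].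
  split=> // y; rewrite -[leRHS]mul1r.
  by move: y; apply/dual_norm_leP => //; rewrite f1.
have f1' y : rnorm (f y : K^o) <= 1 * rnorm y by rewrite mul1r.
split=> //; first exact: bounded_functional_continuous f1'.
apply/eqP; rewrite eq_le; apply/andP; split; first exact/dual_norm_leP.
(* A dual norm below 1 would make |f x| strictly smaller than the norm of [x], against [fx]. *)
rewrite leNgt; apply/negP => fx1.
have dfin : dual_norm f \is a fin_num.
  by rewrite ge0_fin_numE ?dual_norm_ge0// (lt_trans fx1)// ltry.
have : (dual_norm f <= (fine (dual_norm f))%:E)%E by rewrite fineK.
move/(dual_norm_leP f _).1 => /(_ (fine_ge0 (dual_norm_ge0 f)) x).
rewrite fx {1}/rnorm normr_id -/(rnorm x) leNgt gtr_pMl ?rnorm_gt0//.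
by rewrite -lte_fin fineK// fx1.
Qed.

End dual_norm.

(** * Coordinates, embeddings and truncations in the sum *)

Lemma psum_change1 (R : realType) (p : R) (u v : nat -> R) n :
  (forall i, i != n -> u i = v i) ->
  (psum p u + (v n `^ p)%:E = psum p v + (u n `^ p)%:E)%E.
Proof.
move=> uv; have pow0 w (i : nat) : true -> (0 <= (w i `^ p)%:E)%E.
  by rewrite lee_fin powR_ge0.
(* Splitting the n-th term off both series leaves equal remainders; the additive form avoids
   subtracting possibly infinite sums. *)
rewrite /psum (nneseriesD1 (n := n) (pow0 u))//.
rewrite (nneseriesD1 (n := n) (pow0 v))//.
rewrite addeAC [in RHS]addeAC [in RHS](addeC (_ `^ _)%:E); congr (_ + _)%E.
by apply: eq_eseriesr => i /= /uv ->.
Qed.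

Lemma psum_change1_EFin (R : realType) (p a b : R) (u v : nat -> R) n :
  psum p u = a%:E -> psum p v = b%:E -> (forall i, i != n -> u i = v i) ->
  a + v n `^ p = b + u n `^ p.
Proof. by move=> ua vb /(psum_change1 p); rewrite ua vb => -[]. Qed.

Section lpsum_coordinates.
Variables (R : realType) (k : scalar_kind) (p : R) (p1 : 1 <= p).
Local Notation K := (scalars R k).
Variable X : nat -> normedModType K.
Local Notation E := (lpsum p1 X).
Implicit Types x y : E.

Let p0 : 0 < p. Proof. exact: lt_le_trans p1. Qed.

Lemma psum_single n (u : nat -> R) : (forall i, i != n -> u i = 0) ->
  psum p u = (u n `^ p)%:E.
Proof.
move=> u0; have := @psum_change1 _ p u (fun=> 0) n u0.
by rewrite psum0// powR0 ?gt_eqF// adde0 add0e.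
Qed.

Lemma rnorm_lpsum_powR x :
  (rnorm x `^ p)%:E = psum p (fun n => rnorm (x n)).
Proof.
rewrite rnorm_lpsum -powRrM mulVf ?gt_eqF// powRr1.
  by rewrite fineK// psum_fin// lpvalP.
by rewrite fine_ge0// psum_ge0.
Qed.

Lemma lpvalD x y n : (x + y) n = x n + y n.
Proof. by []. Qed.

Lemma lpvalB x y n : (x - y) n = x n - y n.
Proof. by []. Qed.

(** The coordinate map gets a name so that it can carry a linear structure. *)
Definition lpproj n x : X n := x n.

Fact lpproj_linear n : linear (@lpproj n).
Proof. by []. Qed.

HB.instance Definition _ n :=
  GRing.isLinear.Build K E (X n) *:%R (@lpproj n) (@lpproj_linear n).

Fact lpsingle_subproof n (z : X n) :
  (psum p (fun i => rnorm (dfwith (fun j => 0%R : X j) n z i)) < +oo)%E.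
Proof.
rewrite (@psum_single n) ?ltry// => i ni.
by rewrite dfwithout ?rnorm0// eq_sym.
Qed.

Definition lpsingle n (z : X n) : E := LpSum p1 (lpsingle_subproof z).

Lemma lpsingle_eq n (z : X n) : lpsingle z n = z.
Proof. exact: dfwithin. Qed.

Lemma lpsingle_neq n (z : X n) i : n != i -> lpsingle z i = 0.
Proof. exact: dfwithout. Qed.

Fact lpsingle_linear n : linear (@lpsingle n).
Proof.
move=> a y z; apply: lpsumP => i /=.
change (lpsingle (a *: y + z) i = a *: lpsingle y i + lpsingle z i).
have [<-|ni] := eqVneq n i; first by rewrite !lpsingle_eq.
by rewrite !lpsingle_neq// scaler0 addr0.
Qed.

HB.instance Definition _ n :=
  GRing.isLinear.Build K (X n) E *:%R (@lpsingle n) (@lpsingle_linear n).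

(** Only the n-th term of the series changes. This transfers norm inequalities from the sum to the
    single space [X n]. *)
Lemma rnorm_lpsum_change1 x n (z : X n) :
  rnorm (x + lpsingle z) `^ p =
  rnorm x `^ p - rnorm (x n) `^ p + rnorm (x n + z) `^ p.
Proof.
have xz i : i != n -> rnorm ((x + lpsingle z) i) = rnorm (x i).
  by move=> ni; rewrite lpvalD lpsingle_neq ?addr0// eq_sym.
have -> : x n + z = (x + lpsingle z) n by rewrite lpvalD lpsingle_eq.
have := psum_change1_EFin (esym (rnorm_lpsum_powR (x + lpsingle z)))
  (esym (rnorm_lpsum_powR x)) xz.
by move=> xzE; rewrite addrAC -xzE addrK.
Qed.

Lemma rnorm_lpsingle n (z : X n) : rnorm (lpsingle z) = rnorm z.
Proof.
apply: (@powR_injective _ p); rewrite ?nnegrE ?rnorm_ge0//.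
have := @rnorm_lpsum_change1 0 n z; rewrite !add0r rnorm0 powR0 ?gt_eqF//.
rewrite (_ : lpval 0 n = 0)// rnorm0 add0r powR0 ?gt_eqF// => ->.
by rewrite oppr0 add0r.
Qed.

Lemma sum_rnorm_le x N :
  \sum_(i < N) rnorm (x i) `^ p <= rnorm x `^ p.
Proof.
rewrite -lee_fin rnorm_lpsum_powR -sumEFin.
rewrite -(big_mkord xpredT (fun i => (rnorm (x i) `^ p)%:E)).
by apply: nneseries_lim_ge => i _; rewrite lee_fin powR_ge0.
Qed.

Lemma rnorm_coordinate_le x n : rnorm (x n) <= rnorm x.
Proof.
suff : rnorm (x n) `^ p <= rnorm x `^ p.
  apply: contraTT; rewrite -!ltNge => xn.
  by rewrite gt0_ltr_powR ?nnegrE ?rnorm_ge0.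
apply: le_trans (sum_rnorm_le x n.+1); rewrite big_ord_recr /= lerDr.
by rewrite sumr_ge0// => i _; exact: powR_ge0.
Qed.

Lemma lpsum_val_sum (I : Type) (r : seq I) (P : pred I) (F : I -> E) n :
  (\sum_(i <- r | P i) F i : E) n = \sum_(i <- r | P i) (F i n).
Proof. exact: (raddf_sum (@lpproj n)). Qed.

Definition lptrunc N x : E := \sum_(i < N) lpsingle (x i).

Lemma lptruncE N x n : lptrunc N x n = if (n < N)%N then x n else 0.
Proof.
rewrite lpsum_val_sum; case: ltnP => nN.
  rewrite (bigD1 (Ordinal nN))// (lpsingle_eq (x n)) big1 => [|i iN].
    exact: addr0.
  exact: lpsingle_neq.
rewrite big1// => i _; rewrite lpsingle_neq//.
by rewrite ltn_eqF// (leq_trans _ nN).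
Qed.

(** Density of finitely supported sequences: the p-th power of the remainder's norm is the tail of a
    convergent series. *)
Lemma lptrunc_cvg x : rnorm (x - lptrunc N x) `^ p @[N --> \oo] --> (0 : R).
Proof.
have tail N : (rnorm (x - lptrunc N x) `^ p)%:E =
    (\sum_(N <= i <oo) (rnorm (x i) `^ p)%:E)%E.
  rewrite rnorm_lpsum_powR /psum (nneseries_split 0 N) ?add0n; last first.
    by move=> i _; rewrite lee_fin powR_ge0.
  rewrite big_nat big1 ?add0e; last first.
    move=> i /andP[_ iN]; rewrite lpvalB lptruncE iN.
    by rewrite subrr rnorm0 powR0 ?gt_eqF.
  apply: congr_lim; apply/funext => m; apply: eq_big_nat => i /andP[Ni _].
  by rewrite lpvalB lptruncE ltnNge Ni subr0.
have := @nneseries_tail_cvg _ (fun i => (rnorm (x i) `^ p)%:E) xpredT.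
move=> /(_ (lpvalP x)).
have pow0 i : true -> (0 <= (rnorm (x i) `^ p)%:E)%E.
  by rewrite lee_fin powR_ge0.
move=> /(_ pow0).
rewrite (_ : (fun N => _) = fun N => (rnorm (x - lptrunc N x) `^ p)%:E).
  by move=> /fine_cvgP[_].
by apply/funext => N; rewrite tail.
Qed.

End lpsum_coordinates.

(** * Restricting a support functional of the sum to one summand *)

Section support_functionals_lpsum.
Variables (R : realType) (k : scalar_kind) (p : R) (p_gt1 : 1 < p).
Local Notation K := (scalars R k).
Variable X : nat -> normedModType K.
Local Notation E := (lpsum (ltW p_gt1) X).
Local Notation single := (@lpsingle R k p (ltW p_gt1) X _).

Let p0 : 0 < p. Proof. exact: lt_trans p_gt1. Qed.
Let r0 : 0 < p - 1. Proof. by rewrite subr_gt0. Qed.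

Section single_functional.
Variables (x : E) (F : {linear E -> K^o}).
Hypotheses (x1 : rnorm x = 1) (JF : support_functionals x F).

Let x_neq0 : x != 0. Proof. by rewrite -rnorm_gt0 x1. Qed.

Let Fx : real_part (F x : K) = 1.
Proof. by have [-> _] := (support_functionalP F x_neq0).1 JF. Qed.

Let F_le y : rnorm (F y : K^o) <= rnorm y.
Proof. by have [_] := (support_functionalP F x_neq0).1 JF. Qed.

Let FsingleZ n (a : K) (z : X n) :
  F (single (a *: z)) = a * F (single z) :> K.
Proof. by rewrite !linearZ. Qed.

(** Two tangent inequalities are combined: at 1 for the norm of the perturbed sequence, and at the
    norm of [x n + z], evaluated at the norm of [x n], for the coordinate. *)
Lemma real_part_support_le n (z : X n) :
  real_part (F (single z) : K) <=
  rnorm (x n + z) `^ (p - 1) * (rnorm (x n + z) - rnorm (x n)).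
Proof.
have := powR_tangent p_gt1 (rnorm_ge0 (x + single z)) ler01.
rewrite rnorm_lpsum_change1 x1 !powR1 mulr1.
have := powR_tangent p_gt1 (rnorm_ge0 (x n)) (rnorm_ge0 (x n + z)).
have : real_part (F (x + single z) : K) <= rnorm (x + single z).
  exact: le_trans (real_part_le _) (F_le _).
rewrite linearD [leLHS]real_partD Fx.
set c := real_part _; set u := rnorm (x + _); set w := rnorm (x n + z).
set a := rnorm (x n); set v := w `^ (p - 1) => cu h1 h2.
rewrite -(ler_pM2l p0).
have : p * (1 + c - 1) <= p * (u - 1) by rewrite ler_pM2l// lerD2r.
lra.
Qed.

Lemma real_part_support_le_powR n (y : X n) :
  real_part (F (single y) : K) <= rnorm y * rnorm (x n) `^ (p - 1).
Proof.
have [->|y0] := eqVneq y 0.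
  by rewrite !linear0 rnorm0 mul0r -(of_real0 R k) real_partK.
have b0 : 0 < rnorm y by rewrite rnorm_gt0.
apply: le_mul_powR_gt; rewrite ?rnorm_ge0// => w aw.
(* With this scale the triangle inequality puts the norm of x_n + s y below [w]; letting [w]
   decrease to the norm of [x n] amounts to s -> 0. *)
pose s := (w - rnorm (x n)) / rnorm y.
have s0 : 0 < s by rewrite divr_gt0// subr_gt0.
have sb : s * rnorm y = w - rnorm (x n) by rewrite divfK ?gt_eqF.
have := real_part_support_le (of_real s *: y).
have : rnorm (x n + of_real s *: y) <= w.
  by rewrite (le_trans (rnormD _ _))// (rnormZ_of_real _ (ltW s0)) sb; lra.
set W := rnorm (x n + _) => Ww; rewrite FsingleZ [leLHS]real_part_ofM => cW.
rewrite -(ler_pM2l s0) mulrA sb (le_trans cW)// mulrC.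
(* If the perturbation shortens [x n], the left side is at most 0 and the right side is
   nonnegative. *)
have [Wa|Wa] := leP (rnorm (x n)) W; last first.
  rewrite (@le_trans _ _ 0)//.
    by rewrite mulr_le0_ge0 ?powR_ge0// subr_le0 ltW.
  by rewrite mulr_ge0 ?powR_ge0// subr_ge0 ltW.
apply: ler_pM; rewrite ?powR_ge0 ?subr_ge0 ?lerD2r//.
have W0 : 0 <= W by exact: rnorm_ge0.
by rewrite ge0_ler_powR ?nnegrE ?(ltW r0)// (le_trans W0).
Qed.

(** Multiplying [y] by a unimodular scalar makes the value of [F] real and nonnegative, so the
    real-part bound suffices. *)
Lemma rnorm_support_le n (y : X n) :
  rnorm (F (single y) : K^o) <= rnorm y * rnorm (x n) `^ (p - 1).
Proof.
have [u u1 uF] := scalar_rotation (F (single y) : K).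
have := real_part_support_le_powR (u *: y).
by rewrite FsingleZ uF real_partK rnormZ u1 mul1r.
Qed.

Lemma support_coordinate n : F (single (x n)) = of_real (rnorm (x n) `^ p) :> K.
Proof.
have [xn0|xn0] := eqVneq (x n) 0.
  by rewrite xn0 !linear0 rnorm0 powR0 ?gt_eqF// of_real0.
have a0 : 0 < rnorm (x n) by rewrite rnorm_gt0.
apply: real_part_eq_of_real; rewrite -(mulr_powRB1 (ltW a0) p0).
  exact: rnorm_support_le.
apply: ge_mul_powR_lt => // w /andP[w0 wa].
(* The lower bound comes from shrinking the coordinate: (1 - s) x_n has norm [w], and testing with
   -s x_n reverses the inequality. *)
pose s := (rnorm (x n) - w) / rnorm (x n).
have sa : s * rnorm (x n) = rnorm (x n) - w by rewrite divfK ?gt_eqF.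
have s0 : 0 < s by rewrite divr_gt0// subr_gt0.
have s1 : 0 <= 1 - s by rewrite subr_ge0 ler_pdivrMr// mul1r; lra.
have := real_part_support_le (of_real (- s) *: x n).
have -> : x n + of_real (- s) *: x n = of_real (1 - s) *: x n.
  rewrite of_realD scalerDl; congr (_ + _).
  by rewrite of_real1 scale1r.
rewrite (rnormZ_of_real _ s1) FsingleZ [leLHS]real_part_ofM.
have -> : (1 - s) * rnorm (x n) = w by lra.
by move=> H; rewrite -(ler_pM2l s0) mulrA sa; lra.
Qed.

(** Divide the restriction of [F] by its factor [c]: [support_coordinate] then gives the value at
    [x n], and [rnorm_support_le] the norm bound. *)
Lemma support_functional_restriction n : x n != 0 ->
  exists2 phi : {linear X n -> K^o}, support_functionals (x n) phi &
    forall y, F (single y) = of_real (rnorm (x n) `^ (p - 1)) * phi y :> K.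
Proof.
move=> xn0; have a0 : 0 < rnorm (x n) by rewrite rnorm_gt0.
set c := rnorm (x n) `^ (p - 1).
have c0 : 0 < c by rewrite powR_gt0.
have cV0 : 0 <= c^-1 by rewrite invr_ge0 ltW.
pose phi : {linear X n -> K^o} := (of_real c^-1 : K) \*: (F \o single).
have phiE y : phi y = of_real c^-1 * F (single y) :> K by [].
exists phi => [|y]; last first.
  by rewrite phiE mulrA -of_realM mulfV ?gt_eqF// of_real1 mul1r.
apply/support_functionalP => //; split=> [|y].
  rewrite [LHS]phiE support_coordinate -of_realM -of_real_rnorm.
  by rewrite -(mulr_powRB1 (ltW a0) p0) -/c mulrCA mulVf ?gt_eqF// mulr1.
rewrite [X in X <= _](_ : _ = c^-1 * rnorm (F (single y) : K^o)).
  by rewrite ler_pdivrMl// mulrC rnorm_support_le.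
exact: (rnormZ_of_real (F (single y) : K^o) cV0).
Qed.

End single_functional.

(** Here [M] is the sharp constant, obtained on truncations, while the crude bound [C] only supplies
    the continuity that carries [M] over to every [y]. *)
Lemma bounded_on_singles (x : E) (H : {linear E -> K^o}) (M C : R) :
    rnorm x = 1 -> 0 <= M -> 0 <= C ->
    (forall y, rnorm (H y : K^o) <= C * rnorm y) ->
    (forall n (y : X n), rnorm (H (single y) : K^o) <=
      M * (rnorm (x n) `^ (p - 1) * rnorm y)) ->
  (dual_norm H <= M%:E)%E.
Proof.
move=> x1 M0 C0 HC HM; apply: ge_ereal_sup => _ [y /= y1 <-]; rewrite lee_fin.
(* Hoelder's inequality from Young's, term by term: p times the sum is at most 1 + (p - 1), since
   [x] and [y] have norm at most 1. *)
have holder N :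
    \sum_(i < N) rnorm (x i) `^ (p - 1) * rnorm (y i) <= 1.
  rewrite -(ler_pM2l p0) mulr1 mulr_sumr.
  apply: (@le_trans _ _ (\sum_(i < N)
      (rnorm (y i) `^ p + (p - 1) * rnorm (x i) `^ p))).
    apply: ler_sum => i _.
    exact: mul_powR_young p_gt1 (rnorm_ge0 (x i)) (rnorm_ge0 (y i)).
  rewrite big_split -mulr_sumr /=.
  have := sum_rnorm_le y N; have := sum_rnorm_le x N.
  rewrite x1 powR1.
  have : rnorm y `^ p <= 1.
    have := @ge0_ler_powR _ p (ltW p0) (rnorm y) 1.
    by rewrite !nnegrE rnorm_ge0 ler01 powR1 => ->.
  move=> yp1 sx sy.
  rewrite [leRHS](_ : p = 1 + (p - 1)); last by rewrite addrC subrK.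
  by rewrite lerD ?(le_trans sy)// ler_piMr// ltW.
have trunc N : rnorm (H (lptrunc N y) : K^o) <= M.
  apply: (@le_trans _ _ (\sum_(i < N) rnorm (H (single (y i)) : K^o))).
    rewrite /lptrunc linear_sum.
    elim/big_ind2: _ => [|a b c d ab cd|i _]; rewrite ?rnorm0//.
    by rewrite (le_trans (rnormD _ _))// lerD.
  rewrite (@le_trans _ _ (\sum_(i < N)
    M * (rnorm (x i) `^ (p - 1) * rnorm (y i))))//.
    exact: ler_sum.
  by rewrite -mulr_sumr ler_piMr.
apply/ler_addgt0Pr => e e0.
(* Adding 1 to [C] keeps the denominator positive when [C] is 0, and C e/(C + 1) is still at most
   [e]. *)
have d0 : 0 < e / (C + 1) by rewrite divr_gt0// ltr_wpDl.
have /cvgr0Pnorm_lt/(_ _ (powR_gt0 p d0))[N _] := lptrunc_cvg y.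
move=> /(_ N (leqnn N)); rewrite /= ger0_norm ?powR_ge0// => tail.
have {tail}tail : rnorm (y - lptrunc N y) < e / (C + 1).
  rewrite ltNge; apply: contraTN tail => h; rewrite -leNgt.
  by rewrite ge0_ler_powR ?nnegrE ?rnorm_ge0 ?(ltW p0) ?(ltW d0).
rewrite -(subrK (lptrunc N y) y) linearD (le_trans (rnormD _ _))// addrC.
rewrite lerD// (le_trans (HC _))// (@le_trans _ _ (C * (e / (C + 1))))//.
  by rewrite ler_wpM2l// ltW.
by rewrite mulrCA ler_piMr ?(ltW e0)// ler_pdivrMr ?ltr_wpDl// mul1r lerDl.
Qed.

End support_functionals_lpsum.

(** * Comparison of the diameters *)

Section global_diam_lpsum.
Variables (R : realType) (k : scalar_kind) (p : R) (p_gt1 : 1 < p).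
Local Notation K := (scalars R k).
Variable X : nat -> normedModType K.
Local Notation E := (lpsum (ltW p_gt1) X).
Local Notation single := (@lpsingle R k p (ltW p_gt1) X _).

Lemma support_functional_proj n (x : X n) (f : {linear X n -> K^o}) : x != 0 ->
  support_functionals x f ->
  support_functionals (single x) (f \o @lpproj R k p (ltW p_gt1) X n).
Proof.
move=> x0 /(support_functionalP f x0)[fx f1]; apply/support_functionalP.
  by rewrite -rnorm_gt0 rnorm_lpsingle rnorm_gt0.
split=> [|y].
  rewrite (_ : _ (single x) = f (single x n))// lpsingle_eq fx.
  by rewrite -!of_real_rnorm rnorm_lpsingle.
by rewrite (le_trans (f1 _))// rnorm_coordinate_le.
Qed.

(** Composing two support functionals with [lpproj] does not shrink the norm of their difference,
    because [lpsingle] embeds the unit ball of [X n] isometrically. *)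
Lemma local_diam_le_lpsingle n (x : X n) : x != 0 ->
  (local_diam x <= local_diam (single x))%E.
Proof.
move=> x0; apply: ge_ereal_sup => _ [f [g [Jf Jg ->]]].
pose f' : {linear E -> K^o} := f \o @lpproj R k p (ltW p_gt1) X n.
pose g' : {linear E -> K^o} := g \o @lpproj R k p (ltW p_gt1) X n.
apply: (@le_trans _ _ (dual_norm (f' \- g'))); last first.
  apply: ereal_sup_ubound; exists f', g'.
  by split=> //; exact: support_functional_proj.
apply: ereal_sup_le => _ [y /= y1 <-]; exists (single y).
  by rewrite /= rnorm_lpsingle.
have fgE := congr1 (f \- g) (lpsingle_eq (ltW p_gt1) y).
exact: (congr1 (fun t : K^o => (rnorm t)%:E) fgE).
Qed.

Lemma support_functionals_scale (V : normedModType K) (x : V) (a : R) : 0 < a ->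
  support_functionals x `<=` support_functionals (of_real a *: x).
Proof.
move=> a0 f [fc f1 fx]; split=> //; rewrite linearZ /= fx -!of_real_rnorm.
by rewrite (rnormZ_of_real x (ltW a0)) of_realM.
Qed.

Lemma dual_norm_support_sub_le (x : E) (F G : {linear E -> K^o}) (M : R) :
    x != 0 -> support_functionals x F -> support_functionals x G ->
    (forall n, global_diam (X n) <= M%:E)%E ->
  (dual_norm (F \- G)%R <= M%:E)%E.
Proof.
(* Positive scaling of [x] preserves its support functionals. *)
wlog x1 : x / rnorm x = 1.
  move=> wl x0 JF JG; have nx : 0 < (rnorm x)^-1 by rewrite invr_gt0 rnorm_gt0.
  have y1 : rnorm (of_real (rnorm x)^-1 *: x) = 1.
    by rewrite (rnormZ_of_real x (ltW nx)) mulVf ?gt_eqF// rnorm_gt0.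
  apply: (wl _ y1); try exact: support_functionals_scale.
  by rewrite -rnorm_gt0 y1.
move=> x0 JF JG diamM.
(* Both restrictions carry the same factor, which depends on [x] alone, so their difference is that
   factor times a difference of two elements of J(x_n). *)
have diff n (xn0 : x n != 0) : exists phi psi : {linear X n -> K^o},
    (dual_norm (phi \- psi)%R <= M%:E)%E /\ forall y, (F \- G) (single y) =
      of_real (rnorm (x n) `^ (p - 1)) * (phi \- psi) y :> K.
  have [phi Jphi Fphi] := support_functional_restriction x1 JF xn0.
  have [psi Jpsi Gpsi] := support_functional_restriction x1 JG xn0.
  exists phi, psi; split=> [|y]; last by rewrite /= mulrBr -Fphi -Gpsi.
  apply: le_trans (diamM n); apply: (@le_trans _ _ (local_diam (x n))).
    by apply: ereal_sup_ubound; exists phi, psi.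
  by apply: ereal_sup_ubound; exists (x n).
(* A nonzero coordinate gives [0 <= M], as [M] then bounds some dual norm. *)
have [n xn0] : exists n, x n != 0.
  apply/not_existsP => x_eq0; move/eqP: x0; apply; apply: lpsumP => n.
  by apply/eqP; apply: contrapT => /negP; exact: x_eq0.
have M0 : 0 <= M.
  have [phi [psi [phipsi _]]] := diff n xn0.
  by rewrite -lee_fin (le_trans _ phipsi)// dual_norm_ge0.
have le1 H : support_functionals x H -> forall y, rnorm (H y : K^o) <= rnorm y.
  by move=> /(support_functionalP H x0)[].
(* The crude constant is 2 because [F] and [G] are both contractions. *)
apply: (@bounded_on_singles _ _ _ _ _ x _ _ 2) => // [y|m y].
  rewrite (le_trans (rnormD _ _))// rnormN mulr_natl mulr2n.
  by rewrite lerD ?(le1 _ JF) ?(le1 _ JG).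
(* Over a zero coordinate both functionals vanish, since 0^(p-1) = 0 for p > 1. *)
have [xm0|xm0] := eqVneq (x m) 0.
  have := lerD (rnorm_support_le x1 JF y) (rnorm_support_le x1 JG y).
  rewrite xm0 rnorm0 powR0 ?gt_eqF ?subr_gt0// !mulr0 mul0r mulr0 addr0.
  by apply: le_trans; rewrite (le_trans (rnormD _ _))// rnormN.
have [phi [psi [phipsi FGE]]] := diff m xm0.
rewrite [leLHS](congr1 (fun t : K^o => rnorm t) (FGE y)).
rewrite (rnormZ_of_real ((phi \- psi) y : K^o) (powR_ge0 _ _)) mulrCA.
rewrite ler_wpM2l ?powR_ge0//.
by move: y; apply/(dual_norm_leP (phi \- psi) M0).
Qed.

End global_diam_lpsum.

Theorem corollary12 (R : realType) (k : scalar_kind)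
    (X : nat -> normedModType (scalars R k))
    (X_nontrivial : forall n, exists x : X n, x != 0)
    (p : R) (p_gt1 : 1 < p) :
  global_diam (lpsum (ltW p_gt1) X) =
  ereal_sup [set global_diam (X n) | n in [set: nat]].
Proof.
apply/eqP; rewrite eq_le; apply/andP; split; last first.
  apply: ge_ereal_sup => _ [n _ <-]; apply: ge_ereal_sup => _ [x /= x0 <-].
  apply: le_trans (local_diam_le_lpsingle p_gt1 x0) _.
  apply: ereal_sup_ubound; exists (lpsingle (ltW p_gt1) x) => //=.
  by rewrite -rnorm_gt0 rnorm_lpsingle rnorm_gt0.
apply: ge_ereal_sup => _ [x /= x0 <-].
apply: ge_ereal_sup => _ [F [G [JF JG ->]]].
set S := ereal_sup _.
have diamS n : (global_diam (X n) <= S)%E.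
  by apply: ereal_sup_ubound; exists n.
have SM M : (S <= M%:E)%E -> (dual_norm (F \- G)%R <= M%:E)%E.
  move=> SM; apply: (dual_norm_support_sub_le x0 JF JG) => n.
  exact: le_trans (diamS n) SM.
(* If [S] were -oo, every real number would bound the dual norm of [F \- G]; the bound -1
   contradicts its nonnegativity. *)
move: SM; case: S {diamS} => [s|_|SM]; [exact|by rewrite leey|].
have := le_trans (dual_norm_ge0 (F \- G)) (SM (-1) (leNye _)).
by rewrite lee_fin ler0N1.
Qed.
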